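(* Let $\overline{\mathcal{X}}\in\mathbb{X}$ be a stationary point of problem (P) with $(\overline{\lambda},\overline{\mathcal{Y}})\in\mathcal{M}(\overline{\mathcal{X}})$. If the multifunction $\mathcal{J}$ is locally upper Lipschitz at the origin for $(\overline{\mathcal{X}},\overline{\lambda},\overline{\mathcal{Y}})$, then $(\overline{\lambda},\overline{\mathcal{Y}})$ satisfies the strict Robinson constraint qualification \[ \begin{pmatrix}h'(\overline{\mathcal{X}})\\ G'(\overline{\mathcal{X}})\end{pmatrix}\mathbb{X}+\begin{pmatrix}\{0\}\\ \mathcal{T}_K(G(\overline{\mathcal{X}}))\cap\overline{\mathcal{Y}}^{\perp}\end{pmatrix}=\begin{pmatrix}\mathbb{R}^p\\ \mathbb{X}\end{pmatrix}. \]
   Context: Let $m\le n$ and $1\le k\le m$ be integers, $\mathbb{X}=\mathbb{R}\times\mathbb{R}^{m\times n}$ with inner product $\langle(t,X),(s,Y)\rangle=ts+\mathrm{tr}(X^{T}Y)$. For $X\in\mathbb{R}^{m\times n}$ let $\sigma_1(X)\ge\dots\ge\sigma_m(X)$ be its singular values; $K=\{(t,X)\in\mathbb{X}:\sum_{i=1}^k\sigma_i(X)\le t\}$ (Ky Fan $k$-norm cone), $\Pi_K$ the projection onto $K$, $\mathcal{N}_K$ its normal cone, $\mathcal{T}_K$ its contingent cone, $\mathcal{Y}^\perp=\{\mathcal{Z}:\langle\mathcal{Z},\mathcal{Y}\rangle=0\}$. Problem (P): $\min\{f(\mathcal{X}): h(\mathcal{X})=0,\ G(\mathcal{X})\in K\}$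 with $f:\mathbb{X}\to\mathbb{R}$, $h:\mathbb{X}\to\mathbb{R}^p$, $G:\mathbb{X}\to\mathbb{X}$ twice continuously differentiable; $L(\mathcal{X};\lambda,\mathcal{Y})=f(\mathcal{X})+\langle h(\mathcal{X}),\lambda\rangle+\langle G(\mathcal{X}),\mathcal{Y}\rangle$; $\mathcal{M}(\overline{\mathcal{X}})=\{(\lambda,\mathcal{Y}):L'_{\mathcal{X}}(\overline{\mathcal{X}};\lambda,\mathcal{Y})=0,\ \mathcal{Y}\in\mathcal{N}_K(G(\overline{\mathcal{X}}))\}$ for feasible $\overline{\mathcal{X}}$, which is stationary if this set is nonempty. $\Psi(\mathcal{X},\lambda,\mathcal{Y})=\big(L'_{\mathcal{X}}(\mathcal{X};\lambda,\mathcal{Y}),\,h(\mathcal{X}),\,G(\mathcal{X})-\Pi_K(G(\mathcal{X})+\mathcal{Y})\big)$ and $\mathcal{J}(\delta)=\{(\mathcal{X},\lambda,\mathcal{Y}):\Psi(\mathcal{X},\lambda,\mathcal{Y})=\delta\}$ for $\delta\in\mathbb{X}\times\mathbb{R}^p\times\mathbb{X}$. A multifunction $\mathcal{S}$ is locally upper Lipschitz at $\overline{y}$ for $\overline{z}\in\mathcal{S}(\overline{y})$ if there exist $\mu\ge0$ and neighborhoods $\mathcal{U}$ of $\overline{y}$, $\mathcal{V}$ of $\overline{z}$ with $\mathcal{V}\cap\mathcal{S}(\overline{y})=\{\overline{z}\}$ and $\mathcal{S}(y)\cap\mathcal{V}\subseteq\{\overline{z}\}+\mu\|y-\overline{y}\|\mathbb{B}$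 for all $y\in\mathcal{U}$. *)

(* Defs.v *)
From Stdlib Require Import Reals.
From mathcomp Require Import all_boot.
From mathcomp Require Import matrix.

Set Implicit Arguments.
Unset Strict Implicit.
Unset Printing Implicit Defensive.

Local Open Scope R_scope.

Record EucSp := MkE {
  ecar :> Type;
  eadd : ecar -> ecar -> ecar;
  escal : R -> ecar -> ecar;
  ezero : ecar;
  eip : ecar -> ecar -> R }.

Definition esub (E : EucSp) (x y : E) : E := eadd x (escal (-1) y).
Definition enorm (E : EucSp) (x : E) : R := sqrt (eip x x).

Definition Rsum (n : nat) (F : 'I_n -> R) : R := \big[Rplus/0]_(i < n) F i.

Definition RE : EucSp := @MkE R Rplus Rmult 0 Rmult.

Definition RpE (p : nat) : EucSp :=
  @MkE {ffun 'I_p -> R}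
    (fun x y => [ffun i => x i + y i])
    (fun a x => [ffun i => a * x i])
    [ffun _ => 0]
    (fun x y => Rsum (fun i => x i * y i)).

Definition MatE (m n : nat) : EucSp :=
  @MkE 'M[R]_(m, n)
    (fun X Y => matrix_of_fun matrix_key (fun i j => X i j + Y i j))
    (fun a X => matrix_of_fun matrix_key (fun i j => a * X i j))
    (matrix_of_fun matrix_key (fun _ _ => 0))
    (fun X Y => Rsum (fun i : 'I_m => Rsum (fun j : 'I_n => X i j * Y i j))).

Definition prodE (A B : EucSp) : EucSp :=
  @MkE (A * B)%type
    (fun x y => (eadd x.1 y.1, eadd x.2 y.2))
    (fun a x => (escal a x.1, escal a x.2))
    (ezero A, ezero B)
    (fun x y => eip x.1 y.1 + eip x.2 y.2).

Definition XE (m n : nat) : EucSp := prodE RE (MatE m n).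

Definition kdelta (d : nat) (i j : 'I_d) : R := if i == j then 1 else 0.

(* sigma : 'I_m -> R is the vector sigma_1 >= ... >= sigma_m >= 0 of singular
   values of X (m <= n): there are orthogonal U (m x m), V (n x n) with
   X = U [Diag(sigma) 0] V^T. *)
Definition singular_values (m n : nat) (X : 'M[R]_(m, n)) (sigma : 'I_m -> R)
  : Prop :=
  (forall i, 0 <= sigma i) /\
  (forall i j : 'I_m, (i <= j)%N -> sigma j <= sigma i) /\
  exists (U : 'M[R]_m) (V : 'M[R]_n),
    (forall i j : 'I_m, Rsum (fun l : 'I_m => U l i * U l j) = kdelta i j) /\
    (forall i j : 'I_n, Rsum (fun l : 'I_n => V l i * V l j) = kdelta i j) /\
    (forall (i : 'I_m) (j : 'I_n),
       X i j = Rsum (fun l : 'I_m => Rsum (fun l' : 'I_n =>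
                 U i l * (if (nat_of_ord l == nat_of_ord l')%N then sigma l else 0)
                   * V j l'))).

Definition topk_sum (m k : nat) (sigma : 'I_m -> R) : R :=
  \big[Rplus/0]_(i < m | (i < k)%N) sigma i.

Definition KyFanCone (m n k : nat) (z : XE m n) : Prop :=
  exists sigma, singular_values z.2 sigma /\ topk_sum k sigma <= z.1.

Definition is_proj (E : EucSp) (C : E -> Prop) (z q : E) : Prop :=
  C q /\ forall w, C w -> enorm (esub z q) <= enorm (esub z w).

Definition normal_cone (E : EucSp) (C : E -> Prop) (z Y : E) : Prop :=
  C z /\ forall w, C w -> eip Y (esub w z) <= 0.

Definition contingent_cone (E : EucSp) (C : E -> Prop) (z d : E) : Prop :=
  exists (t : nat -> R) (dn : nat -> E),
    (forall k, 0 < t k) /\ Un_cv t 0 /\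
    (forall eps, 0 < eps -> exists N, forall k, (N <= k)%nat ->
        enorm (esub (dn k) d) < eps) /\
    (forall k, C (eadd z (escal (t k) (dn k)))).

Definition is_linear (A B : EucSp) (L : A -> B) : Prop :=
  (forall u v, L (eadd u v) = eadd (L u) (L v)) /\
  (forall a u, L (escal a u) = escal a (L u)).

Definition is_deriv (A B : EucSp) (F : A -> B) (DF : A -> A -> B) : Prop :=
  forall x, is_linear (DF x) /\
   forall eps, 0 < eps -> exists del, 0 < del /\
     forall d, enorm d < del ->
       enorm (esub (esub (F (eadd x d)) (F x)) (DF x d)) <= eps * enorm d.

(* F is twice continuously (Frechet) differentiable; operator norms are
   expressed through the corresponding inequalities. *)
Definition is_C2 (A B : EucSp) (F : A -> B) : Prop :=
  exists (DF : A -> A -> B) (D2F : A -> A -> A -> B),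
    is_deriv F DF /\
    (forall x, (forall u, is_linear (fun d => D2F x d u)) /\
               (forall d, is_linear (D2F x d))) /\
    (forall x eps, 0 < eps -> exists del, 0 < del /\
       forall d u, enorm d < del ->
         enorm (esub (esub (DF (eadd x d) u) (DF x u)) (D2F x d u))
           <= eps * enorm d * enorm u) /\
    (forall x eps, 0 < eps -> exists del, 0 < del /\
       forall y d u, enorm (esub y x) < del ->
         enorm (esub (D2F y d u) (D2F x d u)) <= eps * enorm d * enorm u).

Definition loc_upper_Lipschitz (A B : EucSp) (S : A -> B -> Prop)
  (ybar : A) (zbar : B) : Prop :=
  S ybar zbar /\
  exists mu r1 r2, 0 <= mu /\ 0 < r1 /\ 0 < r2 /\
    (forall z, enorm (esub z zbar) < r2 -> S ybar z -> z = zbar) /\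
    (forall y z, enorm (esub y ybar) < r1 -> enorm (esub z zbar) < r2 ->
       S y z -> enorm (esub z zbar) <= mu * enorm (esub y ybar)).

Section KKT.
Variables (m n k p : nat).
Let X := XE m n.
Variables (Df : X -> X -> RE) (Dh : X -> X -> RpE p) (DG : X -> X -> X)
          (h : X -> RpE p) (G : X -> X).

(* g = L'_X(x; lam, Y), identified with an element of X via <.,.> *)
Definition Lgrad (x : X) (lam : RpE p) (Y : X) (g : X) : Prop :=
  forall d : X, eip g d = Df x d + eip lam (Dh x d) + eip Y (DG x d).

Definition Jmap (delta : prodE X (prodE (RpE p) X))
                (z : prodE X (prodE (RpE p) X)) : Prop :=
  Lgrad z.1 z.2.1 z.2.2 delta.1 /\
  h z.1 = delta.2.1 /\
  exists P : X, is_proj (@KyFanCone m n k) (eadd (G z.1) z.2.2) P /\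
                esub (G z.1) P = delta.2.2.
End KKT.

(* Main.v *)
(** The argument uses of the cone only that it is closed and convex.  If the constraint
    qualification fails, the convex cone of all (h'd, G'd + w), with w in the critical cone
    T_K(G) cap Y^perp, misses a point and is separated from it: there is (mu, Z) <> 0 with
    h'^* mu + G'^* Z = 0 and Z in the polar of the critical cone.  For such Z the projection
    of G + Y + tZ is G + o(t), so (xbar, lambda + t mu, Y + tZ) belongs to J(delta_t) with
    |delta_t| = o(t) although its distance to the reference point is t |(mu, Z)|: this
    contradicts the upper Lipschitz property.
    Closedness and convexity of the Ky Fan cone come from writing it as the intersection of
    the half-spaces sum_(a < k) u_a^T X v_a <= t over orthonormal U and V. *)
Require Import Defs.
From Stdlib Require Import Reals Lra Psatz Classical IndefiniteDescription.
From HB Require Import structures.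
From mathcomp Require Import all_boot.
From mathcomp Require Import matrix.

Set Implicit Arguments.
Unset Strict Implicit.
Unset Printing Implicit Defensive.
Local Open Scope R_scope.

(** * Sums and limits of real numbers *)

(** The image cone need not be closed, so a missed point may have no neighbourhood free of the cone
    and no nearest point in it; in finite dimension a nonzero normal still arises as a limit of unit
    normals found for compact pieces. The direction in the space of variables is free in both signs,
    so the weak inequality given by this normal becomes the adjoint equation. The projection
    estimate is a blow-up: if the projection is G + t w, its variational inequality reads t (|w|^2 -
    <Z,w>) <= <w,Y> <= 0. Hence w stays bounded, its limits as t tends to 0 lie in the critical
    cone, and there |w|^2 <= <Z,w> <= 0. The primal point is kept fixed and the gradient of the
    Lagrangian is affine in the multipliers, so the whole residual sits in the third component of
    Psi. Membership in the cone asserts that some singular value decomposition exists; passing from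
    the half-spaces back to the cone therefore requires constructing one. *)

Lemma RplusA : associative Rplus. Proof. by move=> x y z; ring. Qed.
Lemma RplusC : commutative Rplus. Proof. by move=> x y; ring. Qed.
Lemma Rplus0 : left_id 0 Rplus. Proof. by move=> x; ring. Qed.
HB.instance Definition _ := Monoid.isComLaw.Build R 0 Rplus RplusA RplusC Rplus0.
Lemma Rmul0 : left_zero 0 Rmult. Proof. by move=> x; ring. Qed.
Lemma Rmulr0 : right_zero 0 Rmult. Proof. by move=> x; ring. Qed.
HB.instance Definition _ := Monoid.isMulLaw.Build R 0 Rmult Rmul0 Rmulr0.
Lemma RmulDl : left_distributive Rmult Rplus. Proof. by move=> x y z; ring. Qed.
Lemma RmulDr : right_distributive Rmult Rplus. Proof. by move=> x y z; ring. Qed.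
HB.instance Definition _ := Monoid.isAddLaw.Build R Rmult Rplus RmulDl RmulDr.

Local Notation "\sum_ ( i : t ) F" := (\big[Rplus/0]_(i : t) F) : R_scope.
Local Notation "\sum_ i F" := (\big[Rplus/0]_i F) : R_scope.
Local Notation "\sum_ ( i | P ) F" := (\big[Rplus/0]_(i | P%B) F) : R_scope.
Local Notation "\sum_ ( i : t | P ) F" := (\big[Rplus/0]_(i : t | P%B) F) : R_scope.

Lemma Un_cv_ext (u v : nat -> R) l : (forall n, u n = v n) -> Un_cv u l -> Un_cv v l.
Proof. by move=> h hu e he; have [N hN] := hu e he; exists N => n hn; rewrite -h; apply: hN. Qed.

Section Sums.
Variable I : finType.
Implicit Types (P : pred I) (F G : I -> R).

Lemma le_sum P F G : (forall i, P i -> F i <= G i) ->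
  \sum_(i | P i) F i <= \sum_(i | P i) G i.
Proof. by move=> h; elim/big_rec2: _ => [|i x y Pi]; [lra | have := h i Pi; lra]. Qed.

Lemma sum_ge0 P F : (forall i, P i -> 0 <= F i) -> 0 <= \sum_(i | P i) F i.
Proof. by move=> h; elim/big_rec: _ => [|i x Pi]; [lra | have := h i Pi; lra]. Qed.

Lemma sum_cv P (F : nat -> I -> R) (l : I -> R) :
  (forall i, Un_cv (fun n => F n i) (l i)) ->
  Un_cv (fun n => \sum_(i | P i) F n i) (\sum_(i | P i) l i).
Proof.
move=> h; elim: (index_enum I) => [|i s IH].
  by move=> e he; exists 0%N => n _; rewrite !big_nil R_dist_eq.
rewrite big_cons; apply: (@Un_cv_ext (fun n => if P i then F n i + \big[Rplus/0]_(j <- s | P j) F n j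
   else \big[Rplus/0]_(j <- s | P j) F n j)).
  by move=> n; rewrite big_cons.
by case: (P i) => //; apply: CV_plus.
Qed.

Lemma ge_sum_term F i : (forall j, 0 <= F j) -> F i <= \sum_j F j.
Proof.
move=> h; rewrite (bigD1 i) //=.
by have := @sum_ge0 (fun j => j != i) F (fun j _ => h j); lra.
Qed.
End Sums.

Lemma Un_cv_cst (a : R) : Un_cv (fun _ => a) a.
Proof. by move=> e he; exists 0%N => n _; rewrite R_dist_eq. Qed.

Lemma Un_cv_le (u v : nat -> R) (a b : R) :
  (forall n, u n <= v n) -> Un_cv u a -> Un_cv v b -> a <= b.
Proof. exact: Rle_cv_lim. Qed.

(** Throughout, a subsequence is given by any index map with [n <= phi n]; monotonicity is not
    imposed, since this bound already preserves limits and is stable under composition. *)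
Lemma Un_cv_subseq (u : nat -> R) l (phi : nat -> nat) :
  (forall n, (n <= phi n)%N) -> Un_cv u l -> Un_cv (fun n => u (phi n)) l.
Proof.
move=> hphi hu e he; have [N hN] := hu e he; exists N => n /leP hn; apply: hN.
exact/leP/(leq_trans hn).
Qed.

Lemma Un_cv_inv_INR (a : R) : Un_cv (fun n => a / INR n.+1) 0.
Proof.
apply: (@Un_cv_ext (fun n => a * / INR n.+1)) => //.
rewrite -(Rmult_0_r a); apply: CV_mult; first exact: Un_cv_cst.
move=> e he; have [N [hN hN0]] := archimed_cor1 e he; exists N => n hn.
have h0 : 0 < INR n.+1 by apply: lt_0_INR; apply/ltP.
have h1 : 0 < INR N by apply: lt_0_INR.
rewrite /R_dist Rminus_0_r Rabs_pos_eq; last by apply: Rlt_le; apply: Rinv_0_lt_compat.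
apply: Rle_lt_trans hN; apply: Rinv_le_contravar => //.
by apply: le_INR; apply: (PeanoNat.Nat.le_trans _ _ _ hn); apply: PeanoNat.Nat.le_succ_diag_r.
Qed.

Lemma bounded_subseq (u : nat -> R) (b : R) : (forall n, Rabs (u n) <= b) ->
  exists (phi : nat -> nat) l, (forall n, (n <= phi n)%N) /\ Un_cv (fun n => u (phi n)) l.
Proof.
move=> hb.
have [l hl] : exists l, ValAdh u l.
  apply: (@Bolzano_Weierstrass u (fun x => -b <= x <= b)); first exact: compact_P3.
  by move=> n; have := hb n; split_Rabs; lra.
have hp n : exists p, (n <= p)%N /\ Rabs (u p - l) < 1 / INR n.+1.
  have h0 : 0 < 1 / INR n.+1.
    by apply: Rdiv_lt_0_compat; [lra|apply: lt_0_INR; apply/ltP].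
  have [|p [hp1 hp2]] := hl (disc l (mkposreal _ h0)) n; first by exists (mkposreal _ h0).
  by exists p; split => //; apply/leP.
have [phi hphi] := functional_choice _ hp.
exists phi, l; split; first by move=> n; case: (hphi n).
move=> e he; have [N hN] := Un_cv_inv_INR 1 he; exists N => n hn.
rewrite /R_dist; apply: Rlt_trans (proj2 (hphi n)) _.
by have := hN n hn; rewrite /R_dist Rminus_0_r; split_Rabs; lra.
Qed.

Lemma bounded_subseq_fin (I : finType) (u : nat -> I -> R) (b : R) :
  (forall n i, Rabs (u n i) <= b) ->
  exists (phi : nat -> nat) (l : I -> R), (forall n, (n <= phi n)%N) /\
    forall i, Un_cv (fun n => u (phi n) i) (l i).
Proof.
move=> hb.
suff [phi [l [h1 h2]]] : exists (phi : nat -> nat) (l : I -> R), (forall n, (n <= phi n)%N) /\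
    forall i, i \in enum I -> Un_cv (fun n => u (phi n) i) (l i).
  by exists phi, l; split => // i; apply: h2; rewrite mem_enum.
elim: (enum I) => [|i s [phi [l [h1 h2]]]]; first by exists id, (fun _ => 0).
have [psi [a [g1 g2]]] := @bounded_subseq (fun n => u (phi n) i) b (fun n => hb _ _).
exists (phi \o psi), (fun j => if j == i then a else l j); split.
  by move=> n; apply: leq_trans (g1 n) (h1 _).
move=> j; rewrite inE; case: eqP => [-> _ //|_ /= hj].
exact: (@Un_cv_subseq (fun n => u (phi n) j)) (h2 _ hj).
Qed.

(** * Euclidean spaces with orthonormal coordinates *)

(** [EucSp] is a signature without laws. Coordinates supply them: a vector identity becomes a real
    identity in each coordinate, and compactness reduces to finitely many real sequences. The
    canonical instances attach this structure to the spaces of the statement. *)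
Record coordSp := CoordSp {
  csp :> EucSp;
  cidx : finType;
  coord : csp -> cidx -> R;
  of_coord : (cidx -> R) -> csp;
  of_coordK : forall c i, coord (of_coord c) i = c i;
  coord_inj : forall x y, (forall i, coord x i = coord y i) -> x = y;
  coordD : forall x y i, coord (eadd x y) i = coord x i + coord y i;
  coordZ : forall a x i, coord (escal a x) i = a * coord x i;
  coord0 : forall i, coord (ezero csp) i = 0;
  eipE : forall x y, eip x y = \sum_(i : cidx) (coord x i * coord y i) }.

Definition RE_coordSp : coordSp.
Proof.
refine (@CoordSp RE unit
  (fun x _ => x)
  (fun c => c tt) _ _ _ _ _ _).
- by move=> c [].
- by move=> x y /(_ tt).
- by [].
- by [].
- by [].
- by move=> x y; rewrite (big_pred1 tt) //; case.
Defined.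

Definition RpE_coordSp (p : nat) : coordSp.
Proof.
refine (@CoordSp (RpE p) ('I_p)
  (fun (x : {ffun 'I_p -> R}) i => x i)
  (fun c => [ffun i => c i]) _ _ _ _ _ _).
- by move=> c i; rewrite ffunE.
- by move=> x y h; apply/ffunP.
- by move=> x y i; rewrite ffunE.
- by move=> x y i; rewrite ffunE.
- by move=> i; rewrite ffunE.
- by [].
Defined.

Definition MatE_coordSp (m n : nat) : coordSp.
Proof.
refine (@CoordSp (MatE m n) (('I_m * 'I_n)%type)
  (fun (x : 'M[R]_(m, n)) i => x i.1 i.2)
  (fun c => matrix_of_fun matrix_key (fun i j => c (i, j))) _ _ _ _ _ _).
- by move=> c [i j]; rewrite mxE.
- by move=> x y h; apply/matrixP => i j; apply: (h (i, j)).
- by move=> x y i; rewrite mxE.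
- by move=> x y i; rewrite mxE.
- by move=> i; rewrite mxE.
- by move=> x y; rewrite /= /Rsum pair_bigA.
Defined.

Definition prodE_coordSp (E F : coordSp) : coordSp.
Proof.
refine (@CoordSp (prodE E F) ((cidx E + cidx F)%type)
  (fun x i => match i with inl a => coord x.1 a | inr b => coord x.2 b end)
  (fun c => (of_coord (fun a => c (inl a)), of_coord (fun b => c (inr b)))) _ _ _ _ _ _).
- by move=> c [a|b] /=; rewrite of_coordK.
- move=> [x1 x2] [y1 y2] h; congr pair; apply: coord_inj => i;
    [exact: (h (inl i)) | exact: (h (inr i))].
- by move=> x y [a|b] /=; rewrite coordD.
- by move=> a x [i|i] /=; rewrite coordZ.
- by move=> [i|i] /=; rewrite coord0.
- by move=> x y; rewrite big_sumType /= !eipE.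
Defined.

Canonical RE_coordSp.
Canonical RpE_coordSp.
Canonical MatE_coordSp.
Canonical prodE_coordSp.

Lemma coordB (E : coordSp) (x y : E) i :
  coord (esub x y) i = coord x i - coord y i.
Proof. by rewrite /esub coordD coordZ; ring. Qed.
Ltac vec_eq := apply: coord_inj => ?; rewrite ?(coordB, coordD, coordZ, coord0); try (field; lra).

Section Euclidean.
Variables (E : coordSp).
Implicit Types (x y z : E) (a : R).

Lemma eipC x y : eip x y = eip y x.
Proof. by rewrite !eipE; apply: eq_bigr => i _; ring. Qed.
Lemma eipDl x y z : eip (eadd x y) z = eip x z + eip y z.
Proof. by rewrite !eipE -big_split; apply: eq_bigr => i _ /=; rewrite coordD; ring. Qed.
Lemma eipZl a x y : eip (escal a x) y = a * eip x y.
Proof. by rewrite !eipE big_distrr; apply: eq_bigr => i _ /=; rewrite coordZ; ring. Qed.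
Lemma eipBl x y z : eip (esub x y) z = eip x z - eip y z.
Proof. by rewrite eipDl eipZl; ring. Qed.
Lemma eip0l x : eip (ezero E) x = 0.
Proof. by rewrite eipE big1 // => i _; rewrite coord0; ring. Qed.
Lemma eipDr x y z : eip z (eadd x y) = eip z x + eip z y.
Proof. by rewrite !(eipC z) eipDl. Qed.
Lemma eipZr a x y : eip y (escal a x) = a * eip y x.
Proof. by rewrite !(eipC y) eipZl. Qed.
Lemma eipBr x y z : eip z (esub x y) = eip z x - eip z y.
Proof. by rewrite !(eipC z) eipBl. Qed.
Lemma eip0r x : eip x (ezero E) = 0.
Proof. by rewrite eipC eip0l. Qed.
Definition eip_lin := (eipDl, eipZl, eipBl, eip0l, eipDr, eipZr, eipBr, eip0r).

Lemma coord_sqr_le x i : coord x i * coord x i <= eip x x.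
Proof. by rewrite eipE; apply: (@ge_sum_term _ (fun i => coord x i * coord x i)) => j; nra. Qed.

Lemma eip_ge0 x : 0 <= eip x x.
Proof. by rewrite eipE; apply: sum_ge0 => i _; nra. Qed.

Lemma eip_eq0 x : eip x x <= 0 -> x = ezero E.
Proof.
by move=> h; apply: coord_inj => i; rewrite coord0; have := coord_sqr_le x i; nra.
Qed.

Lemma eip_gt0 x : x <> ezero E -> 0 < eip x x.
Proof. by move=> h; apply: Rnot_le_lt => /eip_eq0. Qed.

Lemma Cauchy_Schwarz x y : eip x y * eip x y <= eip x x * eip y y.
Proof.
have [/eip_eq0 ->|hy] := Rle_lt_dec (eip y y) 0; first by rewrite !eip_lin; lra.
have := eip_ge0 (esub (escal (eip y y) x) (escal (eip x y) y)).
rewrite !eip_lin (eipC y x) => h; nra.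
Qed.

Lemma enorm_ge0 x : 0 <= enorm x. Proof. exact: sqrt_pos. Qed.
Lemma enorm_sqr x : enorm x * enorm x = eip x x.
Proof. exact/sqrt_sqrt/eip_ge0. Qed.
Lemma eip_le_enorm x y : eip x y <= enorm x * enorm y.
Proof.
have := Cauchy_Schwarz x y; rewrite -(enorm_sqr x) -(enorm_sqr y).
by have := enorm_ge0 x; have := enorm_ge0 y => h1 h2 h3; apply: Rsqr_incr_0_var; rewrite /Rsqr; nra.
Qed.
Lemma enorm_le x b : 0 <= b -> eip x x <= b * b -> enorm x <= b.
Proof.
by move=> hb h; apply: Rsqr_incr_0_var => //; rewrite /Rsqr enorm_sqr.
Qed.
Lemma enormZ a x : 0 <= a -> enorm (escal a x) = a * enorm x.
Proof.
move=> ha; have h1 := enorm_ge0 x; have h2 := enorm_sqr x.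
have h3 := enorm_ge0 (escal a x); have := enorm_sqr (escal a x); rewrite !eip_lin => h4.
by apply: Rsqr_inj; rewrite /Rsqr; nra.
Qed.
Lemma enormD x y : enorm (eadd x y) <= enorm x + enorm y.
Proof.
have := enorm_ge0 x; have := enorm_ge0 y; have := eip_le_enorm x y.
have := enorm_sqr x; have := enorm_sqr y => *.
by apply: enorm_le; rewrite ?eip_lin ?(eipC y x); nra.
Qed.

End Euclidean.

Definition ecv (E : coordSp) (u : nat -> E) (l : E) :=
  forall i, Un_cv (fun n => coord (u n) i) (coord l i).
Definition seq_closed (E : coordSp) (C : E -> Prop) :=
  forall u l, (forall n, C (u n)) -> ecv u l -> C l.

Section Convergence.
Variables (E : coordSp).
Implicit Types (u v : nat -> E) (l : E).

Lemma ecv_cst l : ecv (fun _ => l) l.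
Proof. by move=> i; apply: Un_cv_cst. Qed.

Lemma ecvD u v l l' : ecv u l -> ecv v l' -> ecv (fun n => eadd (u n) (v n)) (eadd l l').
Proof.
move=> hu hv i; rewrite coordD; apply: Un_cv_ext (CV_plus _ _ _ _ (hu i) (hv i)) => n.
by rewrite coordD.
Qed.

Lemma ecvZ (a : nat -> R) u b l : Un_cv a b -> ecv u l ->
  ecv (fun n => escal (a n) (u n)) (escal b l).
Proof.
move=> ha hu i; rewrite coordZ; apply: Un_cv_ext (CV_mult _ _ _ _ ha (hu i)) => n.
by rewrite coordZ.
Qed.

Lemma ecvB u v l l' : ecv u l -> ecv v l' -> ecv (fun n => esub (u n) (v n)) (esub l l').
Proof. by move=> hu hv; apply/ecvD/ecvZ/hv => //; apply: Un_cv_cst. Qed.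

Lemma eip_cv u v l l' : ecv u l -> ecv v l' ->
  Un_cv (fun n => eip (u n) (v n)) (eip l l').
Proof.
move=> hu hv; rewrite eipE.
apply: (@Un_cv_ext (fun n => \sum_(i : cidx E) (coord (u n) i * coord (v n) i))).
  by move=> n; rewrite eipE.
by apply: sum_cv => i; apply: CV_mult.
Qed.

Lemma ecv_bounded_subseq u b : (forall n, eip (u n) (u n) <= b) ->
  exists (phi : nat -> nat) l, (forall n, (n <= phi n)%N) /\ ecv (fun n => u (phi n)) l.
Proof.
move=> hb.
have [|phi [l [h1 h2]]] := @bounded_subseq_fin _ (fun n i => coord (u n) i) (b + 1).
  move=> n i; have := coord_sqr_le (u n) i; have := hb n => h1 h2.
  by split_Rabs; nra.
by exists phi, (of_coord l); split => // i; rewrite of_coordK.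
Qed.

Lemma exists_minimizer (C : E -> Prop) (g : E -> R) b :
  seq_closed C -> (forall x, C x -> eip x x <= b) -> (exists x, C x) ->
  (forall u l, ecv u l -> Un_cv (fun n => g (u n)) (g l)) ->
  exists x, C x /\ forall y, C y -> g x <= g y.
Proof.
move=> hC hb [x0 hx0] hg.
(* The infimum of [g] is minus the supremum of [- g]. If [- g] were unbounded, a sequence with
   [- g > n] would have a convergent subsequence along which [g] converges. *)
have hbd : bound (fun y => exists x, C x /\ y = - g x).
  apply: NNPP => hn.
  have [n|u hu] := @functional_choice _ _ (fun n x => C x /\ INR n < - g x).
    apply: NNPP => hn'; apply: hn; exists (INR n) => _ [x [hx ->]].
    by apply: Rnot_lt_le => h; apply: hn'; exists x.
  have [|phi [l [h1 h2]]] := @ecv_bounded_subseq u b.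
    by move=> n; apply: hb; case: (hu n).
  have [N hN] := hg _ _ h2 1 Rlt_0_1.
  have [M hM] := INR_unbounded (- g l + 1).
  have := hN (maxn N M) (elimT leP (leq_maxl _ _)); have := proj2 (hu (phi (maxn N M))).
  have : INR M <= INR (phi (maxn N M)).
    by apply: le_INR; apply/leP/(leq_trans _ (h1 _))/leq_maxr.
  by rewrite /R_dist; split_Rabs; lra.
have [|m [hm1 hm2]] := completeness _ hbd; first by exists (- g x0), x0.
have [n|u hu] := @functional_choice _ _ (fun n x => C x /\ g x < 1 / INR n.+1 - m).
  apply: NNPP => hn'; have h0 : 0 < 1 / INR n.+1.
    by apply: Rdiv_lt_0_compat; [lra|apply: lt_0_INR; apply/ltP].
  have : m <= m - 1 / INR n.+1; last lra.
  apply: hm2 => _ [x [hx ->]]; apply: Rnot_lt_le => h; apply: hn'; exists x; split=> //; lra.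
have [|phi [l [h1 h2]]] := @ecv_bounded_subseq u b.
  by move=> n; apply: hb; case: (hu n).
exists l; split; first by apply: (hC _ _ _ h2) => n; case: (hu (phi n)).
move=> y hy; have := hm1 _ (ex_intro _ y (conj hy erefl)).
suff : g l <= 0 - m by lra.
apply: (@Un_cv_le (fun n => g (u (phi n))) (fun n => 1 / INR (phi n).+1 - m)).
- by move=> n; have := proj2 (hu (phi n)); lra.
- exact: hg.
- apply: CV_minus; last exact: Un_cv_cst.
  exact: (@Un_cv_subseq (fun n => 1 / INR n.+1) _ phi h1 (Un_cv_inv_INR 1)).
Qed.

Lemma eip_esub_bound (z w : E) b : eip (esub z w) (esub z w) <= b ->
  eip w w <= 2 * eip z z + 2 * b.
Proof.
move=> h; have := eip_ge0 (esub (escal 2 z) w); move: h.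
by rewrite !eip_lin (eipC w z); lra.
Qed.

Lemma exists_proj (C : E -> Prop) z : seq_closed C -> (exists x, C x) ->
  exists q, is_proj C z q.
Proof.
move=> hC [x0 hx0]; set b := eip (esub z x0) (esub z x0).
have gcv u l : ecv u l -> Un_cv (fun n => eip (esub z (u n)) (esub z (u n))) (eip (esub z l) (esub z l)).
  by move=> h; apply: eip_cv; apply: ecvB => //; apply: ecv_cst.
(* Points farther from [z] than [x0] are discarded; what remains is bounded, so a minimiser exists
   although [C] may be unbounded. *)
have [||||q [[hq1 hq2] hq3]] := @exists_minimizer (fun w => C w /\ eip (esub z w) (esub z w) <= b)
   (fun w => eip (esub z w) (esub z w)) (2 * eip z z + 2 * b).
- move=> u l hu hl; split; first by apply: (hC u) => // n; case: (hu n).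
  apply: (@Un_cv_le _ (fun _ => b) _ _ (fun n => proj2 (hu n))); [exact: gcv|exact: Un_cv_cst].
- by move=> x [_ /eip_esub_bound].
- by exists x0; split=> //; apply: Rle_refl.
- exact: gcv.
exists q; split=> // w hw; apply: sqrt_le_1_alt.
by have [h|h] := Rle_lt_dec (eip (esub z w) (esub z w)) b; [exact: hq3 | lra].
Qed.
End Convergence.

(** * Convexity, projections and separation *)

Definition convex (E : EucSp) (C : E -> Prop) := forall x y s, 0 <= s <= 1 -> C x -> C y ->
  C (eadd x (escal s (esub y x))).
Arguments convex {E} C.

Lemma first_order (a b : R) : 0 <= b -> (forall s, 0 < s <= 1 -> 2 * a <= s * b) -> a <= 0.
Proof.
move=> hb h; apply: Rnot_lt_le => ha.
(* The choice s = a / (a + b) replaces a limit s -> 0: it lies in (0, 1] even when b = 0, and s b <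
   a contradicts 2 a <= s b. *)
have h1 : 0 < a / (a + b) <= 1.
  have h0 : a / (a + b) * (a + b) = a by field; lra.
  by split; [apply: Rdiv_lt_0_compat; lra|nra].
have := h _ h1; have -> : a / (a + b) * b = a - a * (a / (a + b)) by field; lra.
nra.
Qed.

Lemma sqr_dist_first_order (E : coordSp) (r e : E) :
  (forall s, 0 < s <= 1 -> eip r r <= eip (esub r (escal s e)) (esub r (escal s e))) ->
  eip r e <= 0.
Proof.
move=> h; apply: (@first_order _ (eip e e)); first exact: eip_ge0.
move=> s hs; have := h s hs; rewrite !eip_lin (eipC e r); nra.
Qed.

Lemma proj_variational (E : coordSp) (C : E -> Prop) (z q w : E) :
  convex C -> is_proj C z q -> C w -> eip (esub z q) (esub w q) <= 0.
Proof.
move=> hC [hq hmin] hw; apply: sqr_dist_first_order => s hs.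
have := hmin _ (hC q w s (conj (Rlt_le _ _ (proj1 hs)) (proj2 hs)) hq hw).
have -> : esub z (eadd q (escal s (esub w q))) = esub (esub z q) (escal s (esub w q)) by vec_eq.
rewrite -!enorm_sqr; have := enorm_ge0 (esub z q); nra.
Qed.

(** * Linear maps and separation from the image of a cone *)

Section Linear.
Variables (E F : coordSp).
Variable (L : E -> F).
Hypothesis hL : is_linear L.

Lemma linear0 : L (ezero E) = ezero F.
Proof.
have -> : ezero E = escal 0 (ezero E) by vec_eq.
by rewrite (proj2 hL); vec_eq.
Qed.

(** The matrix of [L]: linearity is purely algebraic here, and continuity is deduced from this
    finite formula. *)
Lemma linear_coord : exists c : cidx E -> cidx F -> R,
  forall x j, coord (L x) j = \sum_(i : cidx E) (coord x i * c i j).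
Proof.
pose e (i : cidx E) : E := of_coord (fun k => if k == i then 1 else 0).
exists (fun i j => coord (L (e i)) j) => x j.
(* [tr s] keeps the coordinates of [x] listed in [s], so that the expansion in the basis can be
   proved by induction on [s]. *)
pose tr (s : seq (cidx E)) : E := of_coord (fun i => if i \in s then coord x i else 0).
have {1}-> : x = tr (index_enum _).
  by apply: coord_inj => i; rewrite of_coordK mem_index_enum.
elim: (index_enum _) (index_enum_uniq (cidx E)) => [_|i s IH /= /andP[his hs]].
  rewrite big_nil; have -> : tr [::] = ezero E.
    by apply: coord_inj => i; rewrite of_coordK coord0.
  by rewrite linear0 coord0.
rewrite big_cons -IH //.
have -> : tr (i :: s) = eadd (escal (coord x i) (e i)) (tr s).
  apply: coord_inj => k; rewrite coordD coordZ !of_coordK inE.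
  by case: eqP => [->|_] /=; rewrite ?(negbTE his); ring.
by rewrite (proj1 hL) (proj2 hL) coordD coordZ.
Qed.

Lemma linear_cv u l : ecv u l -> ecv (fun n => L (u n)) (L l).
Proof.
move=> hu j; have [c hc] := linear_coord; rewrite hc.
apply: (@Un_cv_ext (fun n => \sum_(i : cidx E) (coord (u n) i * c i j))).
  by move=> n; rewrite hc.
by apply: sum_cv => i; apply: CV_mult => //; apply: Un_cv_cst.
Qed.

(* Project [b] on the compact convex image of [C] cut by the ball of radius [n]; the
   normalised residuals accumulate at the normal of a separating hyperplane. *)
Lemma cone_image_separation (C : E -> Prop) (b : F) :
  seq_closed C -> C (ezero E) -> (forall x y, C x -> C y -> C (eadd x y)) ->
  (forall a x, 0 <= a -> C x -> C (escal a x)) ->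
  (forall v, C v -> L v <> b) ->
  exists z, z <> ezero F /\ forall v, C v -> eip z (L v) <= 0.
Proof.
move=> hC hC0 hCD hCZ hb.
have [n|z hz] := @functional_choice _ _ (fun n z => eip z z = 1 /\
    forall v, C v -> eip v v <= 1 -> eip z (L v) <= enorm b / INR n.+1).
  have hn : 0 < INR n.+1 by apply: lt_0_INR; apply/ltP.
  pose Cn v := C v /\ eip v v <= INR n.+1 * INR n.+1.
  pose g v := eip (esub b (L v)) (esub b (L v)).
  have [||||x [[hx1 hx2] hmin]] := @exists_minimizer _ Cn g (INR n.+1 * INR n.+1).
  - move=> u l hu hl; split; first by apply: (hC u) => // k; case: (hu k).
    apply: (@Un_cv_le _ (fun _ => _) _ _ (fun k => proj2 (hu k))); last exact: Un_cv_cst.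
    exact: eip_cv.
  - by move=> x [].
  - by exists (ezero E); split => //; rewrite eip0l; nra.
  - move=> u l hl; apply: eip_cv; apply: ecvB; try exact: ecv_cst; exact: linear_cv.
  have [r rE] : exists r, r = esub b (L x) by exists (esub b (L x)).
  have hr0 : r <> ezero F.
    move=> h0; apply: (hb x hx1); apply: coord_inj => i.
    by have := coordB b (L x) i; rewrite -rE h0 coord0; lra.
  have hr : 0 < enorm r.
    by have := eip_gt0 hr0; have := enorm_ge0 r; rewrite -enorm_sqr; nra.
  have var v : Cn v -> eip r (esub (L v) (L x)) <= 0.
    move=> [hv1 hv2]; apply: sqr_dist_first_order => s hs.
    have -> : esub r (escal s (esub (L v) (L x))) = esub b (L (eadd (escal (1 - s) x) (escal s v))).
      by rewrite (proj1 hL) !(proj2 hL) rE; vec_eq.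
    rewrite rE; apply: hmin; split; first by apply: hCD; apply: hCZ => //; lra.
    have := eip_ge0 (esub x v); rewrite !eip_lin !(eipC v x) => h.
    have h1 : 2 * eip x v <= eip x x + eip v v by lra.
    have h2 : s * (1 - s) * (2 * eip x v) <= s * (1 - s) * (eip x x + eip v v).
      by apply: Rmult_le_compat_l => //; nra.
    have h3 : s * eip v v <= s * (INR n.+1 * INR n.+1) by apply: Rmult_le_compat_l => //; lra.
    have h4 : (1-s) * eip x x <= (1-s) * (INR n.+1 * INR n.+1) by apply: Rmult_le_compat_l => //; lra.
    by nra.
  exists (escal (/ enorm r) r); split.
    by rewrite !eip_lin -enorm_sqr; field; lra.
  move=> v hv1 hv2; rewrite eip_lin.
  (* The point (n+1) v still lies in the ball of radius n+1. Testing with it gives (n+1) <r, L v> <=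
     <r, L x> <= |r| |b|, the source of the bound |b| / (n+1). *)
  have h1 : eip r (esub (L (escal (INR n.+1) v)) (L x)) <= 0.
    apply: var; split; first by apply: hCZ => //; lra.
    by rewrite !eip_lin; have : 0 < INR n.+1 * INR n.+1; nra.
  have h2 : eip r (L x) <= enorm r * enorm b.
    have -> : L x = esub b r by rewrite rE; vec_eq.
    by rewrite eip_lin; have := eip_le_enorm r b; have := eip_ge0 r; lra.
  move: h1; rewrite eip_lin (proj2 hL) eip_lin => h1.
  apply: (Rmult_le_reg_l (INR n.+1 * enorm r)); first by nra.
  have -> : INR n.+1 * enorm r * (/ enorm r * eip r (L v)) = INR n.+1 * eip r (L v) by field; lra.
  have -> : INR n.+1 * enorm r * (enorm b / INR n.+1) = enorm r * enorm b by field; lra.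
  by lra.
have [|phi [l [h1 h2]]] := @ecv_bounded_subseq _ z 1.
  by move=> n; rewrite (proj1 (hz n)); lra.
have hl : eip l l = 1.
  apply: (UL_sequence _ _ _ (eip_cv h2 h2)); apply: Un_cv_ext (Un_cv_cst 1) => n.
  by rewrite (proj1 (hz (phi n))).
exists l; split; first by move=> h0; move: hl; rewrite h0 eip0l; lra.
(* The bound holds on the unit ball only; the factor 1 / (1 + |v|^2) brings any [v] into it. *)
move=> v hv; set a := / (1 + eip v v).
have hv0 := eip_ge0 v.
have ha : 0 < a by apply: Rinv_0_lt_compat; lra.
have ha1 : a * (1 + eip v v) = 1 by rewrite /a; field; lra.
suff : eip l (L (escal a v)) <= 0 by rewrite (proj2 hL) eip_lin; nra.
apply: (@Un_cv_le (fun n => eip (z (phi n)) (L (escal a v))) (fun n => enorm b / INR (phi n).+1)).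
- move=> n; apply: (proj2 (hz (phi n))); first by apply: hCZ => //; lra.
  by rewrite !eip_lin; have : a * eip v v <= 1; nra.
- by apply: eip_cv => //; apply: ecv_cst.
- exact: (@Un_cv_subseq (fun n => enorm b / INR n.+1) _ phi h1 (Un_cv_inv_INR _)).
Qed.
End Linear.

(** * Singular values *)

Lemma sum_delta (I : finType) (f : I -> R) i :
  \sum_j (f j * (if i == j then 1 else 0)) = f i.
Proof.
rewrite (bigD1 i) //= eqxx big1 => [|j /negbTE]; first ring.
by rewrite eq_sym => ->; ring.
Qed.

Lemma sum_sub (I : finType) (f g : I -> R) :
  \sum_i (f i - g i) = \sum_i f i - \sum_i g i.
Proof.
rewrite /Rminus big_split; congr (_ + _).
have -> : - \sum_i g i = -1 * \sum_i g i by ring.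
by rewrite big_distrr; apply: eq_bigr => i _ /=; ring.
Qed.

Lemma sum_mean (I : finType) (f g : I -> R) :
  \sum_i ((f i + g i) / 2) = (\sum_i f i + \sum_i g i) / 2.
Proof. by rewrite -big_split /Rdiv big_distrl. Qed.

(** Used for the weighted trace, in which rotating two columns alters only two terms. *)
Lemma sum_change2 (I : finType) (f g : I -> R) i j : i != j ->
  (forall a, a != i -> a != j -> f a = g a) ->
  \sum_a f a - \sum_a g a = f i - g i + (f j - g j).
Proof.
move=> ij h; rewrite -sum_sub (bigD1 i) //= (bigD1 j) 1?eq_sym //=.
by rewrite big1 => [|a /andP[ai aj]]; [ring | rewrite h //; ring].
Qed.

Lemma sum_change1 (I : finType) (f g : I -> R) i :
  (forall a, a != i -> f a = g a) -> \sum_a f a - \sum_a g a = f i - g i.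
Proof.
move=> h; rewrite -sum_sub (bigD1 i) //=.
by rewrite big1 => [|a ai]; [ring | rewrite h //; ring].
Qed.

Lemma exchange_big22 (I J K L : finType) (f : I -> J -> K -> L -> R) :
  \sum_i \sum_j \sum_k \sum_l f i j k l = \sum_k \sum_l \sum_i \sum_j f i j k l.
Proof.
under eq_bigr => i _ do rewrite exchange_big.
rewrite exchange_big; apply: eq_bigr => k _ /=.
under eq_bigr => i _ do rewrite exchange_big.
by rewrite exchange_big.
Qed.

Lemma exchange_big21 (I J K : finType) (f : I -> J -> K -> R) :
  \sum_i \sum_j \sum_k f i j k = \sum_k \sum_i \sum_j f i j k.
Proof.
by under eq_bigr => i _ do rewrite exchange_big; rewrite exchange_big.
Qed.

(** * Bessel's inequality and operations on orthonormal columns *)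

Section Bessel.
Variables (I J : finType) (U : I -> J -> R).
Hypothesis hU : forall i j, \sum_l (U l i * U l j) = if i == j then 1 else 0.

Lemma Bessel_identity (x : I -> R) (c : J -> R) : (forall j, c j = \sum_l (x l * U l j)) ->
  \sum_l ((x l - \sum_j (c j * U l j)) * (x l - \sum_j (c j * U l j))) =
  \sum_l (x l * x l) - \sum_j (c j * c j).
Proof.
move=> hc; have h1 : \sum_l (x l * \sum_j (c j * U l j)) = \sum_j (c j * c j).
  under eq_bigr => l _ do rewrite big_distrr /=.
  rewrite exchange_big; apply: eq_bigr => j _ /=; rewrite {3}hc big_distrr.
  by apply: eq_bigr => l _ /=; ring.
have h2 : \sum_l ((\sum_j (c j * U l j)) * (\sum_j (c j * U l j))) = \sum_j (c j * c j).
  under eq_bigr => l _ do rewrite big_distrl /=.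
  rewrite exchange_big; apply: eq_bigr => j _ /=.
  under eq_bigr => l _ do rewrite big_distrr /=.
  rewrite exchange_big /= -[c j * c j](sum_delta (fun k => c j * c k)).
  apply: eq_bigr => k _; rewrite -hU big_distrr.
  by apply: eq_bigr => l _ /=; ring.
have -> : \sum_j (c j * c j) = \sum_l (x l * \sum_j (c j * U l j)) +
    (\sum_l (x l * \sum_j (c j * U l j)) - \sum_l ((\sum_j (c j * U l j)) * (\sum_j (c j * U l j)))).
  by rewrite h1 h2; ring.
by rewrite -sum_sub -big_split /= -sum_sub; apply: eq_bigr => l _ /=; ring.
Qed.

Lemma Bessel (x : I -> R) :
  \sum_j ((\sum_l (x l * U l j)) * (\sum_l (x l * U l j))) <= \sum_l (x l * x l).
Proof.
suff : 0 <= \sum_l (x l * x l) - \sum_j ((\sum_l (x l * U l j)) * (\sum_l (x l * U l j))) by lra.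
by rewrite -(@Bessel_identity x _ (fun j => erefl)); apply: sum_ge0 => l _; apply: Rle_0_sqr.
Qed.
End Bessel.

(* The squared lengths of the rows are at most 1 by Bessel and sum to the number of
   columns, so every Bessel inequality for a standard basis vector is an equality. *)
Lemma orthonormal_cols_rows (I : finType) (U : I -> I -> R) :
  (forall i j, \sum_l (U l i * U l j) = if i == j then 1 else 0) ->
  forall i j, \sum_l (U i l * U j l) = if i == j then 1 else 0.
Proof.
move=> hU.
pose e (i l : I) : R := if i == l then 1 else 0.
have he i l : \sum_k (e i k * U k l) = U i l.
  by rewrite -[RHS](sum_delta (fun k => U k l)); apply: eq_bigr => k _; rewrite /e; ring.
have hee i : \sum_l (e i l * e i l) = 1.
  by rewrite -[RHS](sum_delta (fun k => 1) i); apply: eq_bigr => k _; rewrite /e; case: eqP; lra.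
pose D i l := e i l - \sum_j (U i j * U l j).
have hD i : \sum_l (D i l * D i l) = 1 - \sum_j (U i j * U i j).
  by rewrite -(hee i) -(@Bessel_identity _ _ _ hU _ (U i)).
have hsum : \sum_i \sum_l (D i l * D i l) = 0.
  under eq_bigr => i _ do rewrite hD.
  rewrite sum_sub exchange_big -sum_sub big1 // => i _.
  by rewrite hU eqxx; ring.
have hDD i l : 0 <= D i l * D i l by nra.
move=> i j; suff : D i j = 0 by rewrite /D /e; lra.
have := @ge_sum_term _ (fun l => D i l * D i l) j (hDD i).
have := @ge_sum_term _ (fun i => \sum_l (D i l * D i l)) i.
rewrite hsum => h1 h2; have := h1 (fun i => sum_ge0 (fun l _ => hDD i l)).
by have := hDD i j; nra.
Qed.

Definition orthonormal (d : nat) (U : 'M[R]_d) :=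
  forall i j : 'I_d, Rsum (fun l : 'I_d => U l i * U l j) = kdelta i j.

Lemma orthonormal_id (d : nat) :
  orthonormal (matrix_of_fun matrix_key (fun i j : 'I_d => kdelta i j)).
Proof.
move=> i j; rewrite -[RHS](sum_delta (fun l => kdelta l j) i); apply: eq_bigr => l _.
by rewrite !mxE /kdelta (eq_sym i); ring.
Qed.

(** Rotations of two columns and sign changes are both of this form, so their effect on
    orthonormality and on [core] is computed once. *)
Definition mixcols (d : nat) (U : 'M[R]_d) (s : 'I_d -> 'I_d) (al be : 'I_d -> R) : 'M[R]_d :=
  matrix_of_fun matrix_key (fun l a => al a * U l a + be a * U l (s a)).

Definition rotcols (d : nat) (U : 'M[R]_d) (i j : 'I_d) (c t : R) : 'M[R]_d :=
  mixcols U (fun a => if a == i then j else if a == j then i else a)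
    (fun a => if a == i then c else if a == j then c else 1)
    (fun a => if a == i then t else if a == j then - t else 0).

Definition flipcol (d : nat) (U : 'M[R]_d) (i : 'I_d) : 'M[R]_d :=
  mixcols U id (fun a => if a == i then -1 else 1) (fun _ => 0).

Lemma orthonormal_mix (d : nat) (U : 'M[R]_d) s al be : orthonormal U ->
  (forall a b, al a * al b * kdelta a b + al a * be b * kdelta a (s b)
    + be a * al b * kdelta (s a) b + be a * be b * kdelta (s a) (s b) = kdelta a b) ->
  orthonormal (mixcols U s al be).
Proof.
move=> hU h a b; rewrite -h -!hU /Rsum !big_distrr -!big_split.
by apply: eq_bigr => l _ /=; rewrite !mxE; ring.
Qed.

Lemma orthonormal_rot (d : nat) (U : 'M[R]_d) i j c t : i != j -> c * c + t * t = 1 ->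
  orthonormal U -> orthonormal (rotcols U i j c t).
Proof.
move=> ij h hU; apply: orthonormal_mix => // a b; rewrite /kdelta.
have ji : (j == i) = false by rewrite eq_sym (negbTE ij).
have [?|ai] := eqVneq a i; last have [?|aj] := eqVneq a j;
  (have [?|bi] := eqVneq b i; last have [?|bj] := eqVneq b j); subst;
  rewrite ?eqxx ?ji ?(negbTE ij) ?(negbTE ai) ?(negbTE aj) ?(eq_sym i) ?(eq_sym j)
    ?(negbTE bi) ?(negbTE bj) ?ji ?(negbTE ij); lra.
Qed.

Lemma orthonormal_flip (d : nat) (U : 'M[R]_d) i :
  orthonormal U -> orthonormal (flipcol U i).
Proof.
move=> hU; apply: orthonormal_mix => // a b; rewrite /kdelta.
case: (eqVneq a b) => [->|ab]; last by ring.
by case: (b == i); ring.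
Qed.

(** A linear form that is maximal on the unit circle at (1, 0) has its gradient along (1, 0): at the
    normalised gradient it takes the value r = sqrt(al^2 + be^2), and r <= al forces be = 0. *)
Lemma unit_circle_max (al be : R) :
  (forall c t, c * c + t * t = 1 -> c * al + t * be <= al) -> be = 0.
Proof.
move=> h; apply: NNPP => hb.
have hp : 0 < al * al + be * be by nra.
set r := sqrt (al * al + be * be).
have hr : 0 < r by apply: sqrt_lt_R0.
have hr2 : r * r = al * al + be * be by apply: sqrt_sqrt; lra.
have h1 : al / r * (al / r) + be / r * (be / r) = 1.
  by have -> : al / r * (al / r) + be / r * (be / r) = (al * al + be * be) / (r * r);
    [field; lra | rewrite hr2; field; lra].
have := h _ _ h1.
have -> : al / r * al + be / r * be = (al * al + be * be) / r by field; lra.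
rewrite -hr2; have -> : r * r / r = r by field; lra.
nra.
Qed.

(* A pair (U, V) maximising sum_a w_a u_a^T X v_a diagonalises X: rotating two columns of U
   or of V gives w_i M_ji = w_j M_ij and w_i M_ij = w_j M_ji for M = U^T X V, and the weights
   are positive and distinct.  That they decrease sorts the diagonal. *)
Section SVD.
Variables (m n : nat) (hmn : (m <= n)%N) (X : 'M[R]_(m, n)).
Let w (a : 'I_m) : R := INR (m - a)%N.
Let io : 'I_m -> 'I_n := widen_ord hmn.

Definition core (U : 'M[R]_m) (V : 'M[R]_n) (a : 'I_m) (b : 'I_n) : R :=
  \sum_(l : 'I_m) \sum_(l' : 'I_n) (U l a * X l l' * V l' b).

Lemma core_mixl U V s al be a b :
  core (mixcols U s al be) V a b = al a * core U V a b + be a * core U V (s a) b.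
Proof.
rewrite /core !big_distrr -big_split; apply: eq_bigr => l _ /=.
by rewrite !big_distrr -big_split; apply: eq_bigr => l' _ /=; rewrite !mxE; ring.
Qed.

Lemma core_mixr U V s al be a b :
  core U (mixcols V s al be) a b = al b * core U V a b + be b * core U V a (s b).
Proof.
rewrite /core !big_distrr -big_split; apply: eq_bigr => l _ /=.
by rewrite !big_distrr -big_split; apply: eq_bigr => l' _ /=; rewrite !mxE; ring.
Qed.

Lemma core_cv (x : nat -> prodE (MatE m m) (MatE n n)) l a b :
  ecv x l -> Un_cv (fun k => core (x k).1 (x k).2 a b) (core l.1 l.2 a b).
Proof.
move=> h; apply: sum_cv => i; apply: sum_cv => j.
apply: CV_mult; last exact: (h (inr (j, b))).
by apply: CV_mult; [exact: (h (inl (i, a))) | exact: Un_cv_cst].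
Qed.

Definition weighted_core (U : 'M[R]_m) (V : 'M[R]_n) : R :=
  \sum_(a : 'I_m) (w a * core U V a (io a)).

Lemma w_gt0 a : 0 < w a.
Proof. by apply: lt_0_INR; apply/ltP; rewrite subn_gt0. Qed.

Lemma w_lt (a b : 'I_m) : (a < b)%N -> w b < w a.
Proof. by move=> h; apply: lt_INR; apply/ltP; rewrite ltn_sub2l. Qed.

(** Pairs of orthogonal matrices form a compact set: the relations are closed, and the squared
    Frobenius norms are the constants m and n. *)
Lemma exists_maximal_core : exists U V, orthonormal U /\ orthonormal V /\
  forall U' V', orthonormal U' -> orthonormal V' -> weighted_core U' V' <= weighted_core U V.
Proof.
have ortho_cv d (u : nat -> MatE d d) l : (forall k, orthonormal (u k)) -> ecv u l -> orthonormal l.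
  move=> hu h i j; apply: (UL_sequence (fun k => Rsum (fun l0 => u k l0 i * u k l0 j))).
    by apply: sum_cv => a; apply: CV_mult; [exact: (h (a, i)) | exact: (h (a, j))].
  by apply: Un_cv_ext (Un_cv_cst _) => k; rewrite hu.
have ortho_bd d (U : MatE d d) : orthonormal U -> eip U U = INR d.
  move=> hU; rewrite /= /Rsum exchange_big /=.
  rewrite (eq_bigr (fun _ => 1)); last by move=> i _; have := hU i i; rewrite /kdelta eqxx.
  rewrite big_const_ord; elim: d {U hU} => // d IH.
  by rewrite iterS IH S_INR; ring.
have [||||[U V] [[hU hV] hmax]] := @exists_minimizer _
   (fun x : prodE (MatE m m) (MatE n n) => orthonormal x.1 /\ orthonormal x.2)
   (fun x => - weighted_core x.1 x.2) (INR m + INR n).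
- move=> u l hu h; split.
    by apply: (ortho_cv _ (fun k => (u k).1)) => [k|i]; [case: (hu k) | exact: (h (inl i))].
  by apply: (ortho_cv _ (fun k => (u k).2)) => [k|i]; [case: (hu k) | exact: (h (inr i))].
- by move=> x [h1 h2]; rewrite -(ortho_bd _ _ h1) -(ortho_bd _ _ h2); apply: Rle_refl.
- by eexists (_, _); split; apply: orthonormal_id.
- move=> u l h; apply: CV_opp; apply: sum_cv => a.
  by apply: CV_mult; [exact: Un_cv_cst | exact: core_cv].
exists U, V; split=> //; split=> // U' V' h1 h2.
by have := hmax (U', V') (conj h1 h2) => /=; lra.
Qed.

Section Maximal.
Variables (U : 'M[R]_m) (V : 'M[R]_n).
Hypotheses (hU : orthonormal U) (hV : orthonormal V).
Hypothesis hmax : forall U' V', orthonormal U' -> orthonormal V' ->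
  weighted_core U' V' <= weighted_core U V.
Let M := core U V.

Lemma io_inj i j : (io i == io j) = (i == j). Proof. by []. Qed.

Lemma rot_left i j : i != j -> w i * M j (io i) = w j * M i (io j).
Proof.
move=> ij; suff : w i * M j (io i) - w j * M i (io j) = 0 by lra.
apply: (@unit_circle_max (w i * M i (io i) + w j * M j (io j))) => c t ct.
have := Rle_minus _ _ (hmax (orthonormal_rot ij ct hU) hV).
have ji : (j == i) = false by rewrite eq_sym (negbTE ij).
rewrite /weighted_core (sum_change2 ij) => [|a ai aj];
  last by rewrite core_mixl (negbTE ai) (negbTE aj); ring.
rewrite !core_mixl !eqxx ji /M => h; lra.
Qed.

Lemma rot_right i j : i != j -> w i * M i (io j) = w j * M j (io i).
Proof.
move=> ij; suff : w i * M i (io j) - w j * M j (io i) = 0 by lra.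
apply: (@unit_circle_max (w i * M i (io i) + w j * M j (io j))) => c t ct.
have := Rle_minus _ _ (hmax hU (orthonormal_rot (i := io i) (j := io j) ij ct hV)).
have ji : (j == i) = false by rewrite eq_sym (negbTE ij).
rewrite /weighted_core (sum_change2 ij) => [|a ai aj];
  last by rewrite core_mixr !io_inj (negbTE ai) (negbTE aj); ring.
rewrite !core_mixr !io_inj !eqxx ji /M => h; lra.
Qed.

(** A column [b >= m] of [V] carries no weight, so rotating it against column [io i] changes one
    term only, and the coefficient of the sine is w_i M_ib alone. *)
Lemma core_last i (b : 'I_n) : (m <= b)%N -> M i b = 0.
Proof.
move=> hb; have wi := w_gt0 i.
have nb a : (io a == b) = false.
  by apply/eqP => h; have := ltn_ord a; rewrite -[nat_of_ord a]/(nat_of_ord (io a)) h ltnNge hb.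
have ij : io i != b by rewrite nb.
suff : w i * M i b = 0 by nra.
apply: (@unit_circle_max (w i * M i (io i))) => c t ct.
have := Rle_minus _ _ (hmax hU (orthonormal_rot ij ct hV)).
rewrite /weighted_core (@sum_change1 _ _ _ i) => [|a ai];
  last by rewrite core_mixr !io_inj (negbTE ai) nb; ring.
rewrite !core_mixr !eqxx /M => h; lra.
Qed.

Lemma core_offdiag i (b : 'I_n) : nat_of_ord i != b -> M i b = 0.
Proof.
move=> ib; have [hb|hb] := leqP m b; first exact: core_last.
have eb : b = io (Ordinal hb) by apply: val_inj.
set j := Ordinal hb in eb; have ij : i != j by [].
have h1 := rot_left ij; have h2 := rot_right ij; rewrite eb.
have wi := w_gt0 i; have wj := w_gt0 j.
have hw : w i * w i <> w j * w j.
  by case: (ltngtP i j) => [/w_lt|/w_lt|h]; [nra|nra|rewrite -val_eqE /= h eqxx in ij].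
(* Eliminating M_ji from the two rotation identities leaves this equation for M_ij. *)
suff : (w i * w i - w j * w j) * M i (io j) = 0.
  by case/Rmult_integral => //; lra.
have -> : (w i * w i - w j * w j) * M i (io j) = w i * (w i * M i (io j)) - w j * (w j * M i (io j)) by ring.
by rewrite h2 -h1; ring.
Qed.

(** Flipping the sign of column i of [U] negates the i-th term, so maximality makes that term
    nonnegative. *)
Lemma core_diag_ge0 i : 0 <= M i (io i).
Proof.
have := Rle_minus _ _ (hmax (orthonormal_flip i hU) hV).
rewrite /weighted_core (@sum_change1 _ _ _ i) => [|a ai];
  last by rewrite core_mixl (negbTE ai); ring.
rewrite !core_mixl !eqxx /M => h; have := w_gt0 i; nra.
Qed.

Lemma core_diag_sorted (i j : 'I_m) : (i < j)%N -> M j (io j) <= M i (io i).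
Proof.
move=> lij; have wij := w_lt lij.
have ij : i != j by rewrite -val_eqE /= neq_ltn lij.
have ji : (j == i) = false by rewrite eq_sym (negbTE ij).
(* A quarter turn of both [U] and [V] exchanges the diagonal entries i and j, the two signs
   cancelling; maximality then gives (w_i - w_j) (M_ii - M_jj) >= 0. *)
have ct : 0 * 0 + 1 * 1 = 1 by ring.
have := Rle_minus _ _ (hmax (orthonormal_rot ij ct hU) (orthonormal_rot (i := io i) (j := io j) ij ct hV)).
rewrite /weighted_core (sum_change2 ij) => [|a ai aj];
  last by rewrite core_mixl !core_mixr !io_inj (negbTE ai) (negbTE aj); ring.
rewrite !core_mixl !core_mixr !io_inj !eqxx ji /M => h; nra.
Qed.

Lemma core_decomposition i j : X i j =
  Rsum (fun l : 'I_m => Rsum (fun l' : 'I_n =>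
    U i l * (if (nat_of_ord l == nat_of_ord l')%N then M l (io l) else 0) * V j l')).
Proof.
transitivity (Rsum (fun l : 'I_m => Rsum (fun l' : 'I_n => U i l * M l l' * V j l'))); last first.
  apply: eq_bigr => l _; apply: eq_bigr => l' _; case: eqP => [h|/eqP h].
    by congr (_ * M _ _ * _); apply: val_inj.
  by rewrite (core_offdiag h).
have hU' := orthonormal_cols_rows hU; have hV' := orthonormal_cols_rows hV.
rewrite /Rsum /M /core.
(* X = U U^T X V V^T: the identity matrices are inserted as Kronecker deltas and then expanded by
   orthonormality of the rows. *)
transitivity (\sum_(a : 'I_m) \sum_(b : 'I_n) (X a b * (if i == a then 1 else 0) * (if j == b then 1 else 0))).
  rewrite -[LHS](sum_delta (fun a => X a j) i); apply: eq_bigr => a _.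
  by rewrite (sum_delta (fun b => X a b * _) j).
transitivity (\sum_(a : 'I_m) \sum_(b : 'I_n) \sum_(l : 'I_m) \sum_(l' : 'I_n)
    (U i l * (U a l * X a b * V b l') * V j l')).
  apply: eq_bigr => a _; apply: eq_bigr => b _; rewrite -hU' -hV' Rmult_assoc big_distrl big_distrr.
  by apply: eq_bigr => l _ /=; rewrite !big_distrr; apply: eq_bigr => l' _ /=; ring.
rewrite exchange_big22; apply: eq_bigr => l _; apply: eq_bigr => l' _.
rewrite big_distrr big_distrl; apply: eq_bigr => a _ /=.
by rewrite big_distrr big_distrl.
Qed.
End Maximal.

Lemma singular_value_decomposition : exists U V, orthonormal U /\ orthonormal V /\
  singular_values X (fun i => core U V i (io i)).
Proof.
have [U [V [hU [hV hmax]]]] := exists_maximal_core.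
exists U, V; split=> //; split=> //; split; first by move=> i; apply: core_diag_ge0.
split; last by exists U, V; split=> //; split=> // i j; apply: core_decomposition.
move=> i j; rewrite leq_eqVlt => /orP[/eqP/val_inj ->|]; first exact: Rle_refl.
exact: core_diag_sorted.
Qed.
End SVD.

(** * Ky Fan's maximum principle *)

Section KyFan.
Variables (m n k : nat) (hmn : (m <= n)%N) (hkm : (k <= m)%N).
Let io : 'I_m -> 'I_n := widen_ord hmn.

Definition partial_trace (X : 'M[R]_(m, n)) (U : 'M[R]_m) (V : 'M[R]_n) : R :=
  \sum_(a : 'I_m | (a < k)%N) core X U V a (io a).

Lemma sum_ones_ltn : \sum_(i : 'I_m | (i < k)%N) 1 = INR k.
Proof.
rewrite -(big_ord_widen _ (fun _ => 1) hkm) big_const_ord.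
by elim: k => // j IH; rewrite iterS IH S_INR; ring.
Qed.

(* Each weight is at most 1 and the total weight at most [k], so the sum is largest when
   the weight sits on the [k] largest values. *)
Lemma weighted_sum_le_topk (s d : 'I_m -> R) :
  (forall i, 0 <= s i) -> (forall i j : 'I_m, (i <= j)%N -> s j <= s i) ->
  (forall i, 0 <= d i <= 1) -> \sum_i d i <= INR k ->
  \sum_i (s i * d i) <= topk_sum k s.
Proof.
move=> hs0 hs hd hk.
(* [r] separates the k largest values from the rest. Indices start at 0, so it is the value of index
   k, or 0 when k = m. Its sign turns sum d <= k into r (sum d - k) <= 0. *)
have [r hr1 hr2] : exists2 r, 0 <= r /\ (forall i : 'I_m, (i < k)%N -> r <= s i) &
    forall i : 'I_m, ~~ (i < k)%N -> s i <= r.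
  have [h|h] := ltnP k m.
    exists (s (Ordinal h)); first by split=> // i hi; apply: hs; apply: ltnW.
    by move=> i; rewrite -leqNgt => hi; apply: hs.
  exists 0; first by split=> //; lra.
  by move=> i; rewrite (leq_trans (ltn_ord i) h).
have -> : topk_sum k s = \sum_(i : 'I_m) (if (i < k)%N then s i else 0) by rewrite -big_mkcond.
have hK : \sum_(i : 'I_m) (if (i < k)%N then 1 else 0) = INR k.
  by rewrite -big_mkcond sum_ones_ltn.
suff : \sum_(i : 'I_m) (s i * d i - (if (i < k)%N then s i else 0)) <=
    \sum_(i : 'I_m) (r * (d i - (if (i < k)%N then 1 else 0))).
  by rewrite sum_sub -big_distrr /= sum_sub hK; nra.
apply: le_sum => i _; case: ifP => [hi|/negbT hi].
  by have := hr1.2 i hi; have := hd i; nra.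
by have := hr2 i hi; have := hd i; nra.
Qed.

(** With A = P^T U and B the leading m x m block of Q^T V, the a-th diagonal entry of U^T X V is
    sum_l s_l A_la B_la. Since A B <= (A^2 + B^2) / 2, the weights d_l = sum_(a < k) (A_la^2 +
    B_la^2) / 2 dominate. Bessel along the rows gives d_l <= 1, and along the columns sum d <= k. *)
Lemma Ky_Fan_inequality (X : 'M[R]_(m, n)) s U V : singular_values X s ->
  orthonormal U -> orthonormal V -> partial_trace X U V <= topk_sum k s.
Proof.
move=> [hs0 [hs [P [Q [hP [hQ hX]]]]]] hU hV.
have hio (W : 'M[R]_n) : orthonormal W ->
    forall a b : 'I_m, \sum_j (W j (io a) * W j (io b)) = if a == b then 1 else 0.
  by move=> hW a b; apply: hW.
have hVio := hio V hV; have hQio := hio Q hQ.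
pose A l a := \sum_(i : 'I_m) (P i l * U i a).
pose B l a := \sum_(j : 'I_n) (Q j (io l) * V j (io a)).
have hX' i j : X i j = \sum_(l : 'I_m) (P i l * s l * Q j (io l)).
  rewrite hX; apply: eq_bigr => l _; rewrite /Rsum (bigD1 (io l)) //= eqxx big1; first by ring.
  move=> l' hl; have -> : (nat_of_ord l == l') = false.
    by apply/negbTE; move: hl; rewrite -val_eqE eq_sym.
  by ring.
have hcore a : core X U V a (io a) = \sum_l (s l * (A l a * B l a)).
  transitivity (\sum_(i : 'I_m) \sum_(j : 'I_n) \sum_(l : 'I_m) 
    (s l * (P i l * U i a * (Q j (io l) * V j (io a))))).
    apply: eq_bigr => i _; apply: eq_bigr => j _; rewrite hX' big_distrr big_distrl.
    by apply: eq_bigr => l _ /=; ring.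
  rewrite exchange_big21; apply: eq_bigr => l _ /=.
  rewrite /A big_distrl big_distrr; apply: eq_bigr => i _ /=.
  by rewrite /B big_distrr big_distrr.
pose d l := \sum_(a : 'I_m | (a < k)%N) ((A l a * A l a + B l a * B l a) / 2).
apply: (@Rle_trans _ (\sum_l (s l * d l))).
  rewrite /partial_trace; rewrite (eq_bigr _ (fun a _ => hcore a)).
  rewrite exchange_big; apply: le_sum => l _; rewrite -big_distrr.
  apply: Rmult_le_compat_l; first exact: hs0.
  by apply: le_sum => a _; have := Rle_0_sqr (A l a - B l a); rewrite /Rsqr; lra.
apply: weighted_sum_le_topk => //.
  move=> l; split; first by apply: sum_ge0 => a _; nra.
  apply: (@Rle_trans _ (\sum_(a : 'I_m) ((A l a * A l a + B l a * B l a) / 2))).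
    rewrite /d big_mkcond; apply: le_sum => a _; case: ifP => _; [exact: Rle_refl | nra].
  have h1 : \sum_a (A l a * A l a) <= 1.
    have := hP l l; rewrite /kdelta eqxx => <-; exact: (Bessel hU (fun i => P i l)).
  have h2 : \sum_a (B l a * B l a) <= 1.
    have := hQio l l; rewrite eqxx => <-; exact: (Bessel hVio (fun j => Q j (io l))).
  by rewrite sum_mean; lra.
rewrite -sum_ones_ltn.
rewrite exchange_big; apply: le_sum => a _ /=.
have h1 : \sum_l ((\sum_i (U i a * P i l)) * (\sum_i (U i a * P i l))) <= 1.
  have := hU a a; rewrite /kdelta eqxx => <-; exact: (Bessel hP (fun i => U i a)).
have h2 : \sum_(l : 'I_m) ((\sum_i (V i (io a) * Q i (io l))) * \sum_i (V i (io a) * Q i (io l))) <= 1.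
  have := hVio a a; rewrite eqxx => <-; exact: (Bessel hQio (fun j => V j (io a))).
rewrite sum_mean.
have e1 : \sum_l (A l a * A l a) = \sum_l ((\sum_i (U i a * P i l)) * \sum_i (U i a * P i l)).
  have e l : A l a = \sum_i (U i a * P i l) by apply: eq_bigr => i _; ring.
  by apply: eq_bigr => l _; rewrite e.
have e2 : \sum_l (B l a * B l a) = \sum_(l : 'I_m) ((\sum_i (V i (io a) * Q i (io l))) * \sum_i (V i (io a) * Q i (io l))).
  have e l : B l a = \sum_i (V i (io a) * Q i (io l)) by apply: eq_bigr => i _; ring.
  by apply: eq_bigr => l _; rewrite e.
by rewrite e1 e2; lra.
Qed.
End KyFan.

(** * The Ky Fan cone *)

Section KyFanCone.
Variables (m n k : nat) (hmn : (m <= n)%N) (hkm : (k <= m)%N).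

Lemma KyFanConeE (z : XE m n) : KyFanCone k z <->
  forall U V, orthonormal U -> orthonormal V -> partial_trace k hmn z.2 U V <= z.1.
Proof.
split=> [[s [hs hz]] U V hU hV|h].
  exact: Rle_trans (Ky_Fan_inequality hmn hkm hs hU hV) hz.
have [U [V [hU [hV hs]]]] := singular_value_decomposition hmn z.2.
by exists (fun i => core z.2 U V i (widen_ord hmn i)); split=> //; apply: h.
Qed.

Lemma partial_trace_linear U V :
  @is_linear (MatE m n) RE (fun X => partial_trace k hmn X U V).
Proof.
split=> [X Y|a X]; rewrite /partial_trace /core /=.
  rewrite -big_split; apply: eq_bigr => i _; rewrite -big_split; apply: eq_bigr => l _.
  by rewrite -big_split; apply: eq_bigr => l' _ /=; rewrite mxE; ring.
rewrite big_distrr; apply: eq_bigr => i _; rewrite /= big_distrr; apply: eq_bigr => l _ /=.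
by rewrite big_distrr; apply: eq_bigr => l' _ /=; rewrite mxE; ring.
Qed.

Lemma convex_KyFanCone : convex (@KyFanCone m n k).
Proof.
move=> x y s hs /KyFanConeE hx /KyFanConeE hy; apply/KyFanConeE => U V hU hV.
have [hD hZ] := partial_trace_linear U V; rewrite [X in X <= _]hD hZ hD hZ /=.
suff mono (a b c d : R) : c <= a -> d <= b -> c + s * (d + -1 * c) <= a + s * (b + -1 * a).
  exact: mono (hx U V hU hV) (hy U V hU hV).
by nra.
Qed.

Lemma seq_closed_KyFanCone :
  @seq_closed (prodE_coordSp RE_coordSp (MatE_coordSp m n)) (@KyFanCone m n k).
Proof.
move=> u l hu hl; apply/KyFanConeE => U V hU hV.
apply: (@Un_cv_le (fun i => partial_trace k hmn (u i).2 U V) (fun i => (u i).1)).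
- by move=> i; apply: (proj1 (KyFanConeE (u i)) (hu i)).
- have := @linear_cv (MatE_coordSp m n) RE_coordSp _ (partial_trace_linear U V) (fun i => (u i).2) l.2.
  by apply=> [i|]; [exact: (hl (inr i)) | exact: tt].
- exact: (hl (inl tt)).
Qed.
End KyFanCone.

(** * Tangent cones and the projection *)

(* For convex [C] containing [x] this is the contingent cone: no smallness of the step
   has to be asked for, since steps can be shortened. *)
Definition tangent (E : EucSp) (C : E -> Prop) (x w : E) := forall eps, 0 < eps ->
  exists t w', 0 < t /\ enorm (esub w' w) < eps /\ C (eadd x (escal t w')).

Section Tangent.
Variables (E : coordSp) (C : E -> Prop) (x : E).
Hypotheses (hC : convex C) (hx : C x).

Lemma convex_step s t w : 0 < s <= t -> C (eadd x (escal t w)) -> C (eadd x (escal s w)).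
Proof.
move=> hs ht.
have -> : eadd x (escal s w) = eadd x (escal (s / t) (esub (eadd x (escal t w)) x)) by vec_eq.
have hst : s / t * t = s by field; lra.
apply: hC => //; split; first by apply: Rlt_le; apply: Rdiv_lt_0_compat; lra.
by apply: (Rmult_le_reg_r t); lra.
Qed.

Lemma tangent_contingent w : tangent C x w -> contingent_cone C x w.
Proof.
move=> hw.
have hpos n : 0 < 1 / INR n.+1 by apply: Rdiv_lt_0_compat; [lra|apply: lt_0_INR; apply/ltP].
have [n|f hf] := @functional_choice _ _ (fun n (p : R * E) => 0 < p.1 /\
    enorm (esub p.2 w) < 1 / INR n.+1 /\ C (eadd x (escal p.1 p.2))).
  by have [t [w' h]] := hw _ (hpos n); exists (t, w').
have cv0 eps : 0 < eps -> exists N, forall n, (N <= n)%coq_nat -> 1 / INR n.+1 < eps.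
  move=> he; have [N hN] := Un_cv_inv_INR 1 he; exists N => n /hN.
  by rewrite /R_dist Rminus_0_r => h; apply: Rle_lt_trans (Rle_abs _) h.
(* Cutting the steps at 1 / (n+1) makes them tend to 0, and convexity keeps the shortened points in
   [C]. *)
exists (fun n => Rmin (f n).1 (1 / INR n.+1)), (fun n => (f n).2).
have hmin n : 0 < Rmin (f n).1 (1 / INR n.+1) by apply: Rmin_pos => //; case: (hf n).
split=> //; split; last split.
- move=> eps /cv0[N hN]; exists N => n /hN; rewrite /R_dist Rminus_0_r Rabs_pos_eq.
    by apply: Rle_lt_trans; apply: Rmin_r.
  exact/Rlt_le.
- move=> eps /cv0[N hN]; exists N => n /leP/hN; apply: Rlt_trans.
  by case: (hf n) => _ [].
- move=> n; apply: (convex_step (t := (f n).1)); first by split=> //; apply: Rmin_l.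
  by case: (hf n) => _ [].
Qed.

Lemma tangent0 : tangent C x (ezero E).
Proof.
move=> eps he; exists 1, (ezero E); split; first lra.
have -> : eadd x (escal 1 (ezero E)) = x by vec_eq.
split=> //; have -> : esub (ezero E) (ezero E) = ezero E by vec_eq.
by rewrite /enorm eip0l sqrt_0.
Qed.

Lemma tangentZ a w : 0 <= a -> tangent C x w -> tangent C x (escal a w).
Proof.
case=> [ha|<-] hw; last first.
  have -> : escal 0 w = ezero E by vec_eq.
  exact: tangent0.
move=> eps he; have [t [w' [ht [h1 h2]]]] := hw (eps / a) (Rdiv_lt_0_compat _ _ he ha).
exists (t / a), (escal a w'); split; first exact: Rdiv_lt_0_compat.
have -> : eadd x (escal (t / a) (escal a w')) = eadd x (escal t w') by vec_eq.
split=> //; have -> : esub (escal a w') (escal a w) = escal a (esub w' w) by vec_eq.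
rewrite enormZ; last lra.
have -> : eps = a * (eps / a) by field; lra.
exact: Rmult_lt_compat_l.
Qed.

Lemma tangentD v w : tangent C x v -> tangent C x w -> tangent C x (eadd v w).
Proof.
move=> hv hw eps he; have he2 : 0 < eps / 2 by lra.
have [t [v' [ht [hv1 hv2]]]] := hv _ he2; have [s [w' [hs [hw1 hw2]]]] := hw _ he2.
(* With this step, x + ts/(t+s) (v' + w') is the convex combination of x + t v' and x + s w' with
   weights s/(t+s) and t/(t+s). *)
have hts : 0 < t * s / (t + s) by apply: Rdiv_lt_0_compat; nra.
exists (t * s / (t + s)), (eadd v' w'); split=> //; split.
  have -> : esub (eadd v' w') (eadd v w) = eadd (esub v' v) (esub w' w) by vec_eq.
  by have := enormD (esub v' v) (esub w' w); lra.
have -> : eadd x (escal (t * s / (t + s)) (eadd v' w')) =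
    eadd (eadd x (escal t v')) (escal (t / (t + s)) (esub (eadd x (escal s w')) (eadd x (escal t v')))).
  by vec_eq.
have h1 : t / (t + s) * (t + s) = t by field; lra.
by apply: hC => //; nra.
Qed.

Lemma ecv_enorm (u : nat -> E) l eps : ecv u l -> 0 < eps ->
  exists N, forall i, (N <= i)%coq_nat -> enorm (esub (u i) l) < eps.
Proof.
move=> hu he; have h := ecvB hu (@ecv_cst E l); have := eip_cv h h.
have -> : esub l l = ezero E by vec_eq.
rewrite eip0l => /(_ (eps * eps)) [|N hN]; first by nra.
exists N => i /hN; rewrite /R_dist Rminus_0_r -enorm_sqr => /(Rle_lt_trans _ _ _ (Rle_abs _)).
by have := enorm_ge0 (esub (u i) l); nra.
Qed.

Lemma tangent_lim (t : nat -> R) (u : nat -> E) l : (forall i, 0 < t i) -> ecv u l ->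
  (forall i, C (eadd x (escal (t i) (u i)))) -> tangent C x l.
Proof.
move=> ht hu h eps he; have [N hN] := ecv_enorm hu he.
by exists (t N), (u N); split=> //; split=> //; apply: hN.
Qed.

Lemma seq_closed_tangent : seq_closed (tangent C x).
Proof.
move=> u l hu hl eps he; have he2 : 0 < eps / 2 by lra.
have [N hN] := ecv_enorm hl he2; have [t [w [ht [hw1 hw2]]]] := hu N _ he2.
exists t, w; split=> //; split=> //.
have -> : esub w l = eadd (esub w (u N)) (esub (u N) l) by vec_eq.
have := enormD (esub w (u N)) (esub (u N) l).
by have := hN N (PeanoNat.Nat.le_refl _); lra.
Qed.

(* The directional derivative of the projection at [x + Y] vanishes along the polar of
   the critical cone. *)
Lemma proj_derivative_polar Y Z eps : normal_cone C x Y ->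
  (forall w, tangent C x w -> eip w Y = 0 -> eip Z w <= 0) -> 0 < eps ->
  exists t0, 0 < t0 /\ forall t q, 0 < t < t0 ->
    is_proj C (eadd x (eadd Y (escal t Z))) q -> enorm (esub q x) <= eps * t.
Proof.
move=> [_ hY] hZ he; apply: NNPP => hn.
have hpos n : 0 < 1 / INR n.+1 by apply: Rdiv_lt_0_compat; [lra|apply: lt_0_INR; apply/ltP].
(* A pair is a step t and the quotient w = (q - x) / t. Only relations that survive the limit are
   recorded; the last one squeezes <w, Y> to 0. *)
have [n|f hf] := @functional_choice _ _ (fun n (p : R * E) => 0 < p.1 < 1 / INR n.+1 /\
    C (eadd x (escal p.1 p.2)) /\ eps < enorm p.2 /\ eip p.2 Y <= 0 /\
    eip p.2 p.2 <= eip Z p.2 /\ - (1 / INR n.+1) * eip Z Z <= eip p.2 Y).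
  move: (1 / INR n.+1) (hpos n) => e e0.
  apply: NNPP => hn'; apply: hn; exists e; split=> // t q ht hq.
  apply: Rnot_lt_le => hlt; apply: hn'; have t0 : 0 < t by lra.
  have [w qE] : exists w, q = eadd x (escal t w) by exists (escal (/ t) (esub q x)); vec_eq.
  have hwq : esub q x = escal t w by rewrite qE; vec_eq.
  have hYw := hY _ (proj1 hq).
  have hvar := proj_variational hC hq hx.
  exists (t, w) => /=; split=> //; rewrite -qE; split; first exact: (proj1 hq).
  move: hlt; rewrite hwq enormZ; last lra.
  move=> hlt; move: hYw; rewrite hwq eip_lin (eipC Y w) => hYw.
  have hYw0 : eip w Y <= 0 by nra.
  have hv : t * (eip w w - eip Z w) <= eip w Y.
    move: hvar; rewrite qE.
    have -> : esub (eadd x (eadd Y (escal t Z))) (eadd x (escal t w)) = eadd Y (escal t (esub Z w)) by vec_eq.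
    have -> : esub x (eadd x (escal t w)) = escal (- t) w by vec_eq.
    by rewrite !eip_lin (eipC Y w) => hvar; nra.
  have hww : eip w w <= eip Z w by nra.
  have hZZ : eip Z w <= eip Z Z.
    by have := eip_ge0 (esub Z w); rewrite !eip_lin (eipC w Z); lra.
  split; first by nra.
  split=> //; split=> //; apply: Rle_trans hv.
  have := eip_ge0 w; have := eip_ge0 Z => h1 h2.
  have h3 : t * eip Z w <= t * eip Z Z by apply: Rmult_le_compat_l; lra.
  have h4 : t * eip Z Z <= e * eip Z Z by apply: Rmult_le_compat_r; lra.
  by nra.
have [|phi [w [h1 h2]]] := @ecv_bounded_subseq _ (fun n => (f n).2) (eip Z Z).
  move=> n; have [_ [_ [_ [_ [h _]]]]] := hf n.
  by have := eip_ge0 (esub Z (f n).2); rewrite !eip_lin (eipC _ Z); lra.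
have hT : tangent C x w.
  apply: (@tangent_lim (fun n => (f (phi n)).1) (fun n => (f (phi n)).2)) => // n.
    by case: (hf (phi n)); lra.
  by case: (hf (phi n)) => _ [].
have hwY : eip w Y = 0.
  have cvY := eip_cv h2 (@ecv_cst E Y).
  apply: Rle_antisym.
    apply: (@Un_cv_le _ (fun _ => 0) _ _ _ cvY (Un_cv_cst 0)) => n.
    by case: (hf (phi n)) => _ [_ [_ []]].
  have cvZ : Un_cv (fun n => - (1 / INR (phi n).+1) * eip Z Z) (- 0 * eip Z Z).
    apply: CV_mult; last exact: Un_cv_cst.
    apply: CV_opp; exact: (@Un_cv_subseq (fun n => 1 / INR n.+1) _ phi h1 (Un_cv_inv_INR 1)).
  suff : - 0 * eip Z Z <= eip w Y by lra.
  apply: (Un_cv_le _ cvZ cvY) => n.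
  by case: (hf (phi n)) => _ [_ [_ [_ []]]].
have hww : eip w w <= eip Z w.
  apply: (Un_cv_le _ (eip_cv h2 h2) (eip_cv (@ecv_cst E Z) h2)) => n.
  by case: (hf (phi n)) => _ [_ [_ [_ []]]].
have : eps * eps <= eip w w.
  apply: (Un_cv_le _ (Un_cv_cst (eps * eps)) (eip_cv h2 h2)) => n.
  by have [_ [_ [h _]]] := hf (phi n); rewrite -enorm_sqr; nra.
by have := hZ w hT hwY; nra.
Qed.
End Tangent.

(** * From the Lipschitz property to the constraint qualification *)

Theorem mainTheorem2 (m n k p : nat) (hmn : (m <= n)%N) (hk1 : (1 <= k)%N)
  (hkm : (k <= m)%N)
  (f : XE m n -> RE) (h : XE m n -> RpE p) (G : XE m n -> XE m n)
  (Df : XE m n -> XE m n -> RE) (Dh : XE m n -> XE m n -> RpE p)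
  (DG : XE m n -> XE m n -> XE m n) :
  is_C2 f -> is_C2 h -> is_C2 G ->
  is_deriv f Df -> is_deriv h Dh -> is_deriv G DG ->
  forall (xbar : XE m n) (lambar : RpE p) (Ybar : XE m n),
    (* feasibility *)
    h xbar = ezero (RpE p) -> KyFanCone k (G xbar) ->
    (* (lambar, Ybar) in M(xbar) *)
    Lgrad Df Dh DG xbar lambar Ybar (ezero (XE m n)) ->
    normal_cone (@KyFanCone m n k) (G xbar) Ybar ->
    (* J locally upper Lipschitz at the origin for (xbar, lambar, Ybar) *)
    loc_upper_Lipschitz (Jmap k Df Dh DG h G)
      (ezero (prodE (XE m n) (prodE (RpE p) (XE m n))))
      (xbar, (lambar, Ybar)) ->
    (* strict Robinson constraint qualification *)
    forall (a : RpE p) (B : XE m n),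
      exists (d w : XE m n),
        contingent_cone (@KyFanCone m n k) (G xbar) w /\
        eip w Ybar = 0 /\
        Dh xbar d = a /\
        eadd (DG xbar d) w = B.
Proof.
move=> _ _ _ _ hDh hDG xbar lambar Ybar hx hK hgrad hN.
move=> [_ [mu [r1 [r2 [mu0 [r1_gt0 [r2_gt0 [_ hlip]]]]]]]] a B.
have [[hhD hhZ] _] := hDh xbar; have [[hGD hGZ] _] := hDG xbar.
pose X : coordSp := prodE_coordSp RE_coordSp (MatE_coordSp m n).
pose L (v : prodE X X) : prodE (RpE p) X := (Dh xbar v.1, eadd (DG xbar v.1) v.2).
pose A : X := G xbar; pose Y : X := Ybar.
pose C (v : prodE X X) := tangent (@KyFanCone m n k : X -> Prop) A v.2 /\ eip v.2 Y = 0.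
have convK : convex (@KyFanCone m n k : X -> Prop) := convex_KyFanCone hmn hkm.
have closedK : seq_closed (@KyFanCone m n k : X -> Prop) := seq_closed_KyFanCone hmn hkm.
apply: NNPP => hno.
have hL : is_linear L.
  split=> [u v|s u].
    rewrite -[L (eadd u v)]/(Dh xbar (eadd u.1 v.1), eadd (DG xbar (eadd u.1 v.1)) (eadd u.2 v.2)).
    rewrite hhD hGD; congr pair; apply: (@coord_inj X) => i; rewrite !coordD; ring.
  rewrite -[L (escal s u)]/(Dh xbar (escal s u.1), eadd (DG xbar (escal s u.1)) (escal s u.2)).
  rewrite hhZ hGZ; congr pair; apply: (@coord_inj X) => i; rewrite !(coordZ, coordD); ring.
have [|||||[nu Z] [z0 hz]] := @cone_image_separation _ _ L hL C (a, B : X).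
- move=> u l hu hl; have h2 : ecv (fun i => (u i).2) l.2 by move=> i; apply: (hl (inr i)).
  split; first by apply: (seq_closed_tangent _ h2) => i; case: (hu i).
  apply: (UL_sequence _ _ _ (eip_cv h2 (ecv_cst Y))); apply: Un_cv_ext (Un_cv_cst 0) => i.
  by case: (hu i).
- by split; [apply: tangent0 | apply: eip0l].
- move=> u v [hu1 hu2] [hv1 hv2]; split; first exact: tangentD.
  by rewrite [LHS]eipDl hu2 hv2; ring.
- move=> s u hs [hu1 hu2]; split; first exact: tangentZ.
  by rewrite [LHS]eipZl hu2; ring.
- move=> [d w] [hw1 hw2] [h1 h2]; apply: hno; exists d, w; split=> //.
  exact: (tangent_contingent convK hK hw1).
have hadj d : eip nu (Dh xbar d) + eip (Z : X) (DG xbar d) = 0.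
  have sep e : eip nu (Dh xbar e) + eip (Z : X) (DG xbar e) <= 0.
    have : eip nu (Dh xbar e) + eip Z (eadd (DG xbar e : X) (ezero X)) <= 0.
      exact: hz (e, ezero X) (conj (tangent0 hK) (eip0l Y)).
    by rewrite eipDr eip0r Rplus_0_r.
  apply: Rle_antisym; first exact: sep.
  have := sep (escal (-1) d); rewrite hhZ hGZ [eip nu _]eipZr [eip Z _]eipZr; lra.
have hpolar w : tangent (@KyFanCone m n k : X -> Prop) A w -> eip w Y = 0 -> eip (Z : X) w <= 0.
  move=> hw1 hw2.
  (* [escal 0 w] serves as the zero direction, whose images vanish by homogeneity. *)
  have : eip nu (Dh xbar (escal 0 w)) + eip Z (eadd (DG xbar (escal 0 w) : X) w) <= 0.
    exact: hz (escal 0 w, w) (conj hw1 hw2).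
  by rewrite hhZ hGZ eipZr eipDr eipZr; lra.
pose dual : prodE_coordSp (RpE_coordSp p) X := (nu, Z).
pose c := enorm dual.
have c0 : 0 < c.
  by have := eip_gt0 z0; have := enorm_sqr dual; have := enorm_ge0 dual; rewrite -/c -/dual; nra.
(* Chosen so that mu eps < c, the strict inequality that contradicts t c <= mu eps t; the summand 1
   covers mu = 0. *)
pose eps := c / (2 * (mu + 1)).
have eps0 : 0 < eps by apply: Rdiv_lt_0_compat; lra.
have epsE : eps * (2 * (mu + 1)) = c by rewrite /eps; field; lra.
have [t0 [t0_gt0 ht0]] := proj_derivative_polar convK hK hN hpolar eps0.
(* The three bounds keep t in the range of the projection estimate, the perturbed multipliers within
   r2, and the residual, at most eps t, within r1. *)
pose t := Rmin (t0 / 2) (Rmin (r2 / c / 2) (r1 / eps / 2)).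
have r2c : 0 < r2 / c by apply: Rdiv_lt_0_compat.
have r1e : 0 < r1 / eps by apply: Rdiv_lt_0_compat.
have t_gt0 : 0 < t by apply: Rmin_pos; [lra | apply: Rmin_pos; lra].
have t_lt : t < t0 by have := Rmin_l (t0 / 2) (Rmin (r2 / c / 2) (r1 / eps / 2)); rewrite -/t; lra.
have ht' := Rmin_r (t0 / 2) (Rmin (r2 / c / 2) (r1 / eps / 2)); rewrite -/t in ht'.
have t_r2 : t * c < r2.
  have := Rmin_l (r2 / c / 2) (r1 / eps / 2); have : r2 / c * c = r2 by field; lra.
  by nra.
have t_r1 : eps * t < r1.
  have := Rmin_r (r2 / c / 2) (r1 / eps / 2); have : r1 / eps * eps = r1 by field; lra.
  by nra.
have [q hq] := exists_proj (eadd A (eadd Y (escal t (Z : X)))) closedK (ex_intro _ A hK).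
have hqA := ht0 t q (conj t_gt0 t_lt) hq.
pose zt : prodE X (prodE (RpE p) X) := (xbar, (eadd lambar (escal t nu), eadd Y (escal t (Z : X)))).
pose delta : prodE X (prodE (RpE p) X) := (ezero X, (ezero (RpE p), esub A q)).
have hdelta : enorm (esub delta (ezero _)) = enorm (esub q A).
  rewrite /enorm; congr sqrt.
  have -> : esub delta (ezero _) = (ezero X, (ezero (RpE p), esub A q)).
    apply: coord_inj => i; rewrite coordB coord0 /delta; ring.
  have -> : esub q A = escal (-1) (esub A q) by vec_eq.
  rewrite !eip_lin.
  have -> : eip ((ezero X, (ezero (RpE p), esub A q)) : prodE X (prodE (RpE p) X))
      (ezero X, (ezero (RpE p), esub A q))
    = eip (ezero X) (ezero X) + (eip (ezero (RpE p)) (ezero (RpE p)) + eip (esub A q) (esub A q)) by [].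
  by rewrite !eip_lin; ring.
have hzt : enorm (esub zt (xbar, (lambar, Ybar))) = t * c.
  rewrite /c -enormZ /dual; last lra.
  rewrite /enorm; congr sqrt.
  have -> : esub zt (xbar, (lambar, Ybar)) = (ezero X, (escal t nu, escal t (Z : X))).
    transitivity (esub (xbar : X) xbar, (esub (eadd lambar (escal t nu)) lambar,
      esub (eadd Y (escal t (Z : X))) Y)) => //.
    by congr (_, (_, _)); vec_eq.
  transitivity (eip (ezero X) (ezero X) +
    (eip (escal t nu) (escal t nu) + eip (escal t (Z : X)) (escal t (Z : X)))) => //.
  by rewrite eip0l Rplus_0_l.
have hJ : Jmap k Df Dh DG h G delta zt.
  split; last first.
    split; first exact: hx.
    by exists q; split.
  move=> d; have h1 := hgrad d; have h2 := hadj d.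
  rewrite -[delta.1]/(ezero X) -[zt.1]/xbar
    -[zt.2.1]/(eadd lambar (escal t nu)) -[zt.2.2]/(eadd Y (escal t (Z : X))).
  rewrite h1 eipDl eipZl [eip (eadd Y _) _]eipDl eipZl.
  suff lin (x y w u v : R) : u + v = 0 -> x + y + w = x + (y + t * u) + (w + t * v) by exact: lin h2.
  move=> e; have -> : v = - u by lra.
  by ring.
have := hlip delta zt; rewrite hdelta hzt => hl.
have {}hl := hl (Rle_lt_trans _ _ _ hqA t_r1) t_r2 hJ.
have hmu : mu * enorm (esub q A) <= mu * (eps * t) by apply: Rmult_le_compat_l.
have et : 0 < eps * t by apply: Rmult_lt_0_compat.
have met : 0 <= mu * (eps * t) by apply: Rmult_le_pos; lra.
have tcE : t * c = 2 * (mu * (eps * t)) + 2 * (eps * t) by rewrite -epsE; ring.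
have : t * c <= mu * (eps * t) by apply: Rle_trans hl hmu.
lra.
Qed.
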